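(* Let $r\ge1$, $a_0,\dots,a_r\in\mathbb R[x]$ with $a_r\not\equiv0$, and let $K$ be a real, $r$ times differentiable function on an interval with $a_rK^{(r)}+\cdots+a_1K'+a_0K=0$. Let $I_n(x)=\int x^nK(x)\,dx$ $(n\ge0)$, and let $\sum_{k=\ell}^{u}C_k(n)I_{n+k}(x)=E_n(x)$ be the moment recurrence described in the context. Assume $C_u(n)\not\equiv0$ and let $\mathcal E=\{n\in\mathbb Z_{\ge0}:C_u(n)=0\}$. Then $\mathcal E$ is finite. For every $n\in\mathbb Z_{\ge 0}$ with $n\notin\mathcal E$, $$I_{n+u}(x)=-\frac1{C_u(n)}\sum_{k=\ell}^{u-1}C_k(n)I_{n+k}(x)+\frac{E_n(x)}{C_u(n)} .$$ Consequently, after excluding the finitely many resonant indices (the elements of $\mathcal E$), all sufficiently large moments can be reduced recursively to a finite set of initial moments and explicit boundary terms; that is, there is a finite set $S\subset\mathbb Z_{\ge0}$ such that for all sufficiently large $N$, $I_N$ equals, up to an additive constant, a real linear combination of the $I_s$, $s\in S$, plus a finite real linear combination of functions $x^mK^{(i)}(x)$, $m\ge0$, $0\le i\le r-1$.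
   Context: Write $a_j(x)=\sum_{s=0}^{d_j}a_{j,s}x^s$, $d_j=\deg a_j$ (zero $a_j$ are omitted), and let $(t)_{\underline j}=t(t-1)\cdots(t-j+1)$, $(t)_{\underline0}=1$. Multiplying the differential equation by $x^n$ and integrating by parts gives, for $n\ge0$, the recurrence $\sum_kC_k(n)I_{n+k}(x)=E_n(x)$ with $$C_k(n)=\sum_{\substack{0\le j\le r,\ 0\le s\le d_j\\ s-j=k}}(-1)^ja_{j,s}(n+s)_{\underline j}\in\mathbb R[n],$$ $$E_n(x)=-\sum_{j=1}^{r}\sum_{s=0}^{d_j}a_{j,s}\sum_{t=0}^{j-1}(-1)^t(n+s)_{\underline t}\,x^{n+s-t}K^{(j-1-t)}(x).$$ Put $\ell=\min\{k:C_k\not\equiv0\}$ and $u=\max\{k:C_k\not\equiv0\}$. $\int f\,dx$ denotes an antiderivative; identities hold up to additive constants. Terms with zero coefficient are read as zero; in particular $C_k(n)=0$ whenever $n+k<0$. *)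

(* Defs.v *)
From HB Require Import structures.
From mathcomp Require Import all_boot all_order all_algebra finmap.
From mathcomp Require Import all_classical all_reals all_analysis.

Set Implicit Arguments.
Unset Strict Implicit.
Unset Printing Implicit Defensive.

Import Order.TTheory GRing.Theory Num.Theory.
Import numFieldNormedType.Exports.

Local Open Scope classical_set_scope.
Local Open Scope ring_scope.

Section DerivativeOnInterval.
Context {R : realType}.
Implicit Types (D : set R) (f F : R -> R).

(* Derivatives are relative to D: at an endpoint belonging to D they are
   one-sided, and the values of f outside D never matter at a point of D. *)
Definition has_deriv_on D f (x l : R) : Prop :=
  (f y - f x) / (y - x) @[y --> within D x^'] --> l.

Definition derivable_on D f : Prop :=
  forall x, D x -> exists l, has_deriv_on D f x l.

Definition deriv_on D f : R -> R :=
  fun x => lim ((f y - f x) / (y - x) @[y --> within D x^']).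

Definition derivn_on D (i : nat) f : R -> R := iter i (deriv_on D) f.

Definition n_times_derivable_on D (n : nat) f : Prop :=
  forall i, (i < n)%N -> derivable_on D (derivn_on D i f).

Definition antiderivative_on D f F : Prop :=
  forall x, D x -> has_deriv_on D F x (f x).

End DerivativeOnInterval.

Definition proper_interval {R : realType} (D : set R) : Prop :=
  is_interval D /\ exists x y, [/\ D x, D y & x < y].

(* t (t - 1) ... (t - j + 1), used both for scalars and for polynomials in n *)
Definition falling {A : comNzRingType} (t : A) (j : nat) : A :=
  \prod_(i < j) (t - i%:R).

Section MomentRecurrence.
Context {R : realType}.
Context (r : nat) (a : nat -> {poly R}).

(* The indeterminate 'X stands for n; s ranges up to deg (a j), and not at all
   when a j = 0. *)
Definition moment_coef (k : int) : {poly R} :=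
  \sum_(j < r.+1) \sum_(s < size (a j) | s%:Z - j%:Z == k)
    ((-1) ^+ j * (a j)`_s) *: falling ('X + s%:R%:P) j.

(* The truncated exponent n + s - t is harmless: falling (n + s)%:R t = 0
   as soon as n + s < t. *)
Definition boundary_term (D : set R) (K : R -> R) (n : nat) (x : R) : R :=
  - \sum_(1 <= j < r.+1) \sum_(s < size (a j)) (a j)`_s *
      \sum_(t < j) (-1) ^+ t * falling ((n + s)%:R : R) t *
        x ^+ (n + s - t) * derivn_on D (j - 1 - t) K x.

Definition resonant (u : int) : set nat :=
  [set n | (moment_coef u).[n%:R] = 0].

Lemma falling_nat_eq0 (m j : nat) : (m < j)%N -> falling (m%:R : R) j = 0.
Proof. by move=> mj; rewrite /falling (bigD1 (Ordinal mj)) //= subrr mul0r. Qed.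

(* Justifies the junk value in moment_at below. *)
Lemma moment_coef_eq0 (k : int) (n : nat) :
  n%:Z + k < 0 -> (moment_coef k).[n%:R] = 0.
Proof.
move=> nk; rewrite /moment_coef horner_sum big1// => j _.
rewrite horner_sum big1// => s /eqP sjk.
have nsj : (n + s < j)%N.
  by move: nk; rewrite -sjk addrA subr_lt0 -PoszD ltz_nat.
rewrite hornerZ /falling horner_prod.
rewrite (eq_bigr (fun i : 'I_j => (n + s)%:R - i%:R)) => [|i _].
  by rewrite -/(falling _ _) falling_nat_eq0 ?mulr0.
by rewrite -[i%:R]polyC_natr !hornerE -natrD.
Qed.

End MomentRecurrence.

Definition moment_at {R : realType} (I : nat -> R -> R) (m : int) : R -> R :=
  if m is Posz p then I p else fun=> 0.

(* Main.v *)
(* Integrating x^n a_j(x) K^(j)(x) by parts amounts to the telescoping identity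
   (sum_(t < j) (-1)^t (m)_t x^(m-t) K^(j-1-t))'
     = x^m K^(j) - (-1)^j (m)_j x^(m-j) K.
   Summed against the coefficients of the a_j with m = n + s, the first terms
   vanish by the differential equation, so sum_k C_k(n) I_{n+k} - E_n has zero
   derivative and is constant on the interval.  A nonzero C_u has finitely many
   roots, so beyond some index the recurrence can be solved for its top moment,
   and strong induction reduces every moment to the finitely many before it. *)

Require Import Defs.
From HB Require Import structures.
From mathcomp Require Import all_boot all_order all_algebra finmap.
From mathcomp Require Import all_classical all_reals all_analysis.
From mathcomp Require Import ring lra zify.

Set Implicit Arguments.
Unset Strict Implicit.
Unset Printing Implicit Defensive.

Import Order.TTheory GRing.Theory Num.Theory.
Import numFieldNormedType.Exports.
Local Open Scope classical_set_scope.
Local Open Scope ring_scope.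

(** * Calculus of derivatives relative to an interval *)

Section RelativeDerivative.
Context {R : realType}.
Implicit Types (D : set R) (f g : R -> R) (x : R).

Lemma near_punctured D x (P : set R) : (forall y, y != x -> P y) ->
  \forall y \near within D x^', P y.
Proof. by move=> xP; apply: (@nearW _ (nbhs x)) => y yx _; exact: xP. Qed.

Lemma has_deriv_on_cst D (c x : R) : has_deriv_on D (fun=> c) x 0.
Proof.
rewrite /has_deriv_on; under eq_fun do rewrite subrr mul0r.
exact: cvg_cst.
Qed.

Lemma has_deriv_on_id D x : has_deriv_on D id x 1.
Proof.
have : (fun=> 1 : R) y @[y --> within D x^'] --> (1 : R) by exact: cvg_cst.
apply: cvg_trans; apply: near_eq_cvg; apply: near_punctured => y yx.
by rewrite divff// subr_eq0.
Qed.

(** Off [x], [f y] is [f x] plus the difference quotient times [y - x], and the last factor tends to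
    0. *)
Lemma has_deriv_on_continuous D f x l : has_deriv_on D f x l ->
  f y @[y --> within D x^'] --> f x.
Proof.
move=> fl.
have xD : y @[y --> within D x^'] --> x.
  by apply: cvg_within_filter; exact: cvg_within.
have cD (c : R) : (fun=> c) y @[y --> within D x^'] --> c by exact: cvg_cst.
have : f x + (f y - f x) / (y - x) * (y - x) @[y --> within D x^']
    --> f x + l * (x - x).
  by apply: cvgD (cD _) (cvgM fl (cvgB xD (cD x))).
rewrite subrr mulr0 addr0; apply: cvg_trans; apply: near_eq_cvg.
apply: near_punctured => y yx.
by rewrite /= divfK ?subr_eq0// addrC subrK.
Qed.

Lemma has_deriv_onD D f g x (l m : R) :
  has_deriv_on D f x l -> has_deriv_on D g x m ->
  has_deriv_on D (fun y => f y + g y) x (l + m).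
Proof.
move=> fl gm; rewrite /has_deriv_on.
under eq_fun do rewrite opprD addrACA mulrDl.
by apply: cvgD fl gm.
Qed.

Lemma has_deriv_onM D f g x (l m : R) :
  has_deriv_on D f x l -> has_deriv_on D g x m ->
  has_deriv_on D (fun y => f y * g y) x (l * g x + f x * m).
Proof.
move=> fl gm; rewrite /has_deriv_on.
(* The increment of the product is split so that [f] is taken at the moving point [y]; continuity of
   [f] then gives the limit. *)
rewrite (_ : (fun y => _) = fun y => (f y - f x) / (y - x) * g x
    + f y * ((g y - g x) / (y - x))); last by apply/funext => y; ring.
apply: cvgD; apply: cvgM => //; first exact: cvg_cst.
exact: has_deriv_on_continuous fl.
Qed.

Lemma has_deriv_onZ D (c : R) f x l :
  has_deriv_on D f x l -> has_deriv_on D (fun y => c * f y) x (c * l).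
Proof.
move=> fl; have := has_deriv_onM (has_deriv_on_cst D c x) fl.
by rewrite mul0r add0r.
Qed.

Lemma has_deriv_onX D (n : nat) x :
  has_deriv_on D (fun y => y ^+ n) x (n%:R * x ^+ n.-1).
Proof.
elim: n => [|n IHn].
  by under eq_fun do rewrite expr0; rewrite mul0r; exact: has_deriv_on_cst.
under eq_fun do rewrite exprS.
have := has_deriv_onM (has_deriv_on_id D x) IHn.
(* The case 0 is separate because of the truncated exponent [n.-1], harmless there since its
   coefficient vanishes. *)
congr has_deriv_on; case: n {IHn} => [|n] /=; first by rewrite mul0r mulr0 addr0.
by rewrite -(natr1 n.+1) exprS; ring.
Qed.

Lemma has_deriv_onN D f x l :
  has_deriv_on D f x l -> has_deriv_on D (fun y => - f y) x (- l).
Proof.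
move=> fl; rewrite -mulN1r (_ : (fun y => - f y) = fun y => -1 * f y).
  exact: has_deriv_onZ.
by apply/funext => y; rewrite mulN1r.
Qed.

Lemma has_deriv_on_sum D (J : eqType) (s : seq J) (P : pred J)
    (f : J -> R -> R) (df : J -> R) x :
  (forall i, i \in s -> P i -> has_deriv_on D (f i) x (df i)) ->
  has_deriv_on D (fun y => \sum_(i <- s | P i) f i y) x (\sum_(i <- s | P i) df i).
Proof.
elim: s => [|i s IHs] fdf.
  under eq_fun do rewrite big_nil; rewrite big_nil; exact: has_deriv_on_cst.
under eq_fun do rewrite big_cons; rewrite big_cons.
have {}IHs := IHs (fun k ks => fdf k (@mem_behead _ (i :: s) k ks)).
by case: ifPn => // Pi; apply: has_deriv_onD => //; exact: fdf (mem_head _ _) Pi.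
Qed.

(** Each point of a nondegenerate interval is an accumulation point of it: move towards [b] if
    [x < b], otherwise towards [a]. Limits along this filter are therefore unique, so that
    [deriv_on], defined by [lim], is the actual derivative. *)
Lemma within_dnbhs_proper D x : proper_interval D -> D x ->
  ProperFilter (within D x^').
Proof.
move=> [Ditv [a [b [Da Db ab]]]] Dx; apply: Build_ProperFilter => D0.
have /nbhs_ballP[e /= e0 De] : nbhs x (fun y => y != x -> ~ D y) := D0.
have [xb|bx] := ltP x b.
(* The step [e / 2] keeps [y] strictly inside the ball, and the cap at [b] keeps it in [D]. *)
- pose y := Num.min b (x + e / 2).
  have xy : x < y by rewrite lt_min xb ltrDl divr_gt0.
  have ye : y <= x + e / 2 by rewrite ge_min lexx orbT.
  apply: (De y); last 2 first.
  + by rewrite gt_eqF.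
  + by apply: (Ditv x b) => //; rewrite (ltW xy) ge_min lexx.
  by rewrite /ball /= ltr0_norm; lra.
- pose y := Num.max a (x - e / 2).
  have xy : y < x by rewrite gt_max (lt_le_trans ab bx) ltrBlDr ltrDl divr_gt0.
  have ye : x - e / 2 <= y by rewrite le_max lexx orbT.
  apply: (De y); last 2 first.
  + by rewrite lt_eqF.
  + by apply: (Ditv a x) => //; rewrite (ltW xy) le_max lexx.
  by rewrite /ball /= gtr0_norm; lra.
Qed.

Lemma has_deriv_on_deriv D f x : proper_interval D -> derivable_on D f -> D x ->
  has_deriv_on D f x (deriv_on D f x).
Proof.
move=> Ditv Df Dx; have [l fl] := Df x Dx.
have FP := within_dnbhs_proper Ditv Dx.
suff -> : deriv_on D f x = l by [].
by apply: cvg_lim => //; exact: Rhausdorff.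
Qed.

Lemma has_deriv_on_interior D f x l : nbhs x D -> has_deriv_on D f x l ->
  is_derive x 1 f l.
Proof.
move=> xD fl; apply/is_derive1_caratheodory.
(* This is the slope function of Caratheodory. Its continuity at [x] is the relative limit, since
   [D] contains a neighbourhood of [x]. *)
exists (fun z => if z == x then l else (f z - f x) / (z - x)).
rewrite eqxx; split => // [z|].
  have [->|zx] := eqVneq z x; first by rewrite !subrr mulr0.
  by rewrite divfK// subr_eq0.
apply/continuous_withinNx; rewrite eqxx.
move=> U /fl fU.
apply: (@filterS2 _ (nbhs x)) xD fU => z Dz + zx; rewrite /= (negPf zx); exact.
Qed.

(** The mean value theorem is applied on a segment with ends in [D]: relative derivatives are
    two-sided in its interior, and at its ends only continuity within the segment is required. *)
Lemma has_deriv_on_eq0_cst D f : is_interval D ->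
  (forall x, D x -> has_deriv_on D f x 0) ->
  exists c, forall x, D x -> f x = c.
Proof.
move=> Ditv f0.
have f_eq x y : D x -> D y -> x < y -> f x = f y.
  move=> Dx Dy xy; apply/esym/subr0_eq.
  have sub z : x <= z <= y -> D z by exact: Ditv.
  have [z||z _ ->] := @MVT _ f (fun=> 0) x y xy; last by rewrite mul0r.
  - move=> zxy; apply: (@has_deriv_on_interior D).
      apply: filterS (near_in_itvoo zxy) => t; rewrite in_itv/= => /andP[xt ty].
      by apply: sub; rewrite !ltW.
    by apply: f0; apply: sub; move: zxy; rewrite in_itv/= => /andP[? ?]; rewrite !ltW.
  - apply/subspace_continuousP => z; rewrite /= in_itv/= => zxy.
    have /= fz := has_deriv_on_continuous (f0 z (sub z zxy)).
    move=> U Uf; apply: (@filterS _ (nbhs z)) (fz U Uf) => t + txy.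
    have [->|tz] := eqVneq t z; first by move=> _; exact: nbhs_singleton Uf.
    by apply=> //; apply: sub; move: txy; rewrite /= in_itv.
have [[x0 Dx0]|D0] := pselect (exists x, D x); last first.
  by exists 0 => x Dx; case: D0; exists x.
exists (f x0) => x Dx.
by have [/f_eq->|/f_eq->|->] := ltgtP x x0.
Qed.

End RelativeDerivative.

(** * Natural roots of a nonzero polynomial *)

Lemma polynomial_finite_nat_roots (R : numDomainType) (p : {poly R}) :
  p != 0 -> finite_set [set n : nat | p.[n%:R] = 0].
Proof.
(* An infinite root set would contain at least [size p] distinct roots, more than the degree
   allows. *)
move=> p0; apply: contrapT => /(infinite_set_fset (size p))[B pB].
apply/negP; rewrite -ltnNge -(size_map (fun n => n%:R : R)).
apply: max_poly_roots => //.
  by apply/allP => _ /mapP[n nB ->]; apply/rootP; exact: pB.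
by rewrite map_inj_uniq ?fset_uniq// => m n /eqP; rewrite eqr_nat => /eqP.
Qed.

(** * Sums over ranges of integers *)

Section IntegerRanges.
Context {V : nmodType}.
Implicit Types H : int -> V.

(** The window of length [N] starting at [k] covers [[l, u]], which contains the support of [H]; the
    pieces below [l] and above [u] vanish. *)
Lemma sum_int_interval (k l u : int) (N : nat) H :
  (forall i, H i != 0 -> l <= i <= u) -> k <= l -> l <= u -> u < k + N%:Z ->
  \sum_(i < N) H (k + i%:Z) = \sum_(0 <= i < `|u - l|.+1) H (l + i%:Z).
Proof.
move=> Hlu kl lu uN; rewrite -(big_mkord xpredT (fun i => H (k + i%:Z))).
have H0 i : ~~ (l <= i <= u) -> H i = 0 by move=> /(contra (Hlu i)) /negPn/eqP.
rewrite (@big_cat_nat _ _ _ `|l - k|)//=; last lia.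
rewrite big_nat_cond big1 ?add0r => [|i]; last first.
  by move=> ?; apply: H0; lia.
rewrite (@big_cat_nat _ _ _ (`|l - k| + `|u - l|.+1))//=; [|lia|lia].
rewrite [X in _ + X]big_nat_cond [X in _ + X]big1 ?addr0 => [|i]; last first.
  by move=> ?; apply: H0; lia.
rewrite -{1}[(`|l - k|)%N]add0n big_addn addKn; apply: eq_bigr => i _.
by congr H; lia.
Qed.

End IntegerRanges.

(** * The moment recurrence *)

Section MomentRecurrence.
Context {R : realType}.
Context (r : nat) (a : nat -> {poly R}).
Implicit Types (D : set R) (K : R -> R).

Lemma fallingS (t : R) (j : nat) : falling t j.+1 = falling t j * (t - j%:R).
Proof. by rewrite /falling big_ord_recr. Qed.

Lemma horner_falling (n s j : nat) :
  (falling ('X + s%:R%:P) j : {poly R}).[n%:R] = falling (n + s)%:R j.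
Proof.
rewrite /falling horner_prod; apply: eq_bigr => i _.
by rewrite -[i%:R]polyC_natr !hornerE -natrD.
Qed.

(** The contribution of the monomial a_(j,s) x^s to C_(s-j)(n), kept apart before grouping by k = s
    - j. *)
Let weight (n j s : nat) : R :=
  (-1) ^+ j * (a j)`_s * falling (n + s)%:R j.

(** Each pair (j, s) lies on exactly one diagonal s - j = k, so summing over diagonals is summing
    over pairs. [G] will be the moments shifted by [n]. *)
Lemma sum_moment_coef (l u : int) (n : nat) (G : int -> R) :
  moment_coef r a l != 0 ->
  (forall k, moment_coef r a k != 0 -> l <= k <= u) ->
  \sum_(0 <= i < `|u - l|.+1) (moment_coef r a (l + i%:Z)).[n%:R] * G (l + i%:Z)
  = \sum_(j < r.+1) \sum_(s < size (a j)) weight n j s * G (s%:Z - j%:Z).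
Proof.
move=> Cl Clu; have /andP[_ lu] := Clu l Cl.
(* The window from [k] to [k + N - 1] is chosen to contain [[l, u]] and every difference s - j at
   once, so that the sums can be exchanged over a fixed range. *)
pose k : int := - (`|l| + r)%N%:Z.
pose N := (`|l| + r + `|u|.+1 + \sum_(j < r.+1) size (a j))%N.
rewrite -(@sum_int_interval _ k l u N
    (fun i => (moment_coef r a i).[n%:R] * G i)) //; last 3 first.
- move=> i iG; apply: Clu; apply: contraNneq iG => ->.
  by rewrite horner0 mul0r.
- by rewrite /k; lia.
- by rewrite /k /N; lia.
under eq_bigr => i _.
  rewrite /moment_coef horner_sum mulr_suml.
  under eq_bigr => j _.
    rewrite horner_sum mulr_suml.
    under eq_bigr => s /eqP <- do rewrite hornerZ horner_falling -/(weight n j s).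
    over.
  over.
rewrite exchange_big /=; apply: eq_bigr => j _.
under eq_bigr do rewrite big_mkcond.
rewrite exchange_big /=; apply: eq_bigr => s _.
have sizej : (size (a j) <= \sum_(j < r.+1) size (a j))%N.
  by rewrite (bigD1 j)//= leq_addr.
have iN : (absz (s%:Z - j%:Z - k)%R < N)%N.
  move: sizej (ltn_ord s) (ltn_ord j); rewrite {}/N {}/k.
  by move: (nat_of_ord j) (size (a j)) (\sum_(_ < _) _)%N (nat_of_ord s); lia.
(* Only the index i = s - j - k survives. *)
rewrite (bigD1 (Ordinal iN))//= big1 ?addr0 => [|i ik].
  by rewrite ifT//; apply/eqP; rewrite /k; have := ltn_ord j; lia.
rewrite ifF//; apply: contraNF ik => /eqP sji; apply/eqP/val_inj => /=.
by rewrite sji; lia.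
Qed.

Lemma has_deriv_on_boundary D K (m j : nat) x : proper_interval D -> D x ->
  n_times_derivable_on D j K ->
  has_deriv_on D
    (fun y => \sum_(t < j) (-1) ^+ t * falling m%:R t *
                y ^+ (m - t) * derivn_on D (j - 1 - t) K y) x
    (x ^+ m * derivn_on D j K x -
       (-1) ^+ j * falling m%:R j * x ^+ (m - j) * K x).
Proof.
move=> Ditv Dx Kj.
(* The summand of index [t] has derivative [U t - U t.+1]: differentiating the factor K^(j-1-t)
   gives the first term, differentiating the power of x the second. *)
pose U t : R := (-1) ^+ t * falling m%:R t * x ^+ (m - t) *
  derivn_on D (j - t) K x.
have -> : x ^+ m * derivn_on D j K x -
    (-1) ^+ j * falling m%:R j * x ^+ (m - j) * K x = \sum_(t < j) (U t - U t.+1).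
  rewrite -(big_mkord xpredT (fun t => U t - U t.+1)).
  under eq_bigr do rewrite -opprB.
  rewrite sumrN GRing.telescope_sumr// opprB /U subnn !subn0 /falling big_ord0.
  by rewrite expr0 !mul1r.
apply: has_deriv_on_sum => t _ _.
have Kt : has_deriv_on D (derivn_on D (j - 1 - t) K) x (derivn_on D (j - t) K x).
  have -> : (j - t)%N = (j - 1 - t).+1 by have := ltn_ord t; lia.
  by apply: has_deriv_on_deriv => //; apply: Kj; have := ltn_ord t; lia.
under eq_fun do rewrite -mulrA.
have := has_deriv_onZ (c := (-1) ^+ t * falling m%:R t)
  (has_deriv_onM (@has_deriv_onX _ D (m - t) x) Kt).
congr has_deriv_on.
(* Also valid for m < t, where m - t is truncated but (m)_t = 0. *)
have fm : falling (m%:R : R) t * (m - t)%:R = falling m%:R t.+1.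
  rewrite fallingS; have [tm|mt] := leqP t m; first by rewrite natrB.
  by rewrite falling_nat_eq0// !mul0r.
rewrite /U -fm -subnDA add1n -subnS exprS; ring.
Qed.

Lemma has_deriv_on_boundary_term D K (n : nat) x : proper_interval D -> D x ->
  n_times_derivable_on D r K ->
  \sum_(j < r.+1) (a j).[x] * derivn_on D j K x = 0 ->
  has_deriv_on D (boundary_term r a D K n) x
    (\sum_(j < r.+1) \sum_(s < size (a j)) weight n j s * x ^+ (n + s - j) * K x).
Proof.
move=> Ditv Dx Kr ode.
(* [B j s] is the derivative of the inner sum over [t], by the previous lemma with [m = n + s]. *)
pose B (j s : nat) := x ^+ (n + s) * derivn_on D j K x -
  (-1) ^+ j * falling (n + s)%:R j * x ^+ (n + s - j) * K x.
have -> : \sum_(j < r.+1) \sum_(s < size (a j)) weight n j s * x ^+ (n + s - j) * K x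
    = - \sum_(1 <= j < r.+1) \sum_(s < size (a j)) (a j)`_s * B j s.
  (* The index j = 0, absent from the boundary term, can be added because [B 0 s = 0]. The leading
     terms of [B] then sum to x^n times the differential equation. *)
  transitivity (- \sum_(j < r.+1) \sum_(s < size (a j)) (a j)`_s * B j s).
    transitivity (- (x ^+ n * (\sum_(j < r.+1) (a j).[x] * derivn_on D j K x)) +
      \sum_(j < r.+1) \sum_(s < size (a j)) weight n j s * x ^+ (n + s - j) * K x).
      by rewrite ode mulr0 oppr0 add0r.
    rewrite mulr_sumr -!sumrN -big_split/=; apply: eq_bigr => j _.
    rewrite horner_coef mulr_suml mulr_sumr -!sumrN -big_split/=.
    by apply: eq_bigr => s _; rewrite /B /weight exprD; ring.
  rewrite -(big_mkord xpredT (fun j => \sum_(s < size (a j)) (a j)`_s * B j s)).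
  rewrite big_ltn// [X in X + _]big1 ?add0r// => s _.
  by rewrite /B /falling big_ord0 subn0 expr0 !mul1r subrr mulr0.
apply: has_deriv_onN; apply: has_deriv_on_sum => j + _.
rewrite mem_index_iota => /andP[_ jr].
apply: has_deriv_on_sum => s _ _.
apply: has_deriv_onZ; apply: has_deriv_on_boundary => // i ij.
by apply: Kr; exact: leq_trans ij jr.
Qed.

Lemma moment_recurrence D K (I : nat -> R -> R) (l u : int) (n : nat) :
  proper_interval D -> n_times_derivable_on D r K ->
  (forall x, D x -> \sum_(j < r.+1) (a j).[x] * derivn_on D j K x = 0) ->
  (forall n, antiderivative_on D (fun x => x ^+ n * K x) (I n)) ->
  moment_coef r a l != 0 ->
  (forall k, moment_coef r a k != 0 -> l <= k <= u) ->
  exists c, forall x, D x ->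
    \sum_(0 <= i < `|u - l|.+1)
      (moment_coef r a (l + i%:Z)).[n%:R] * moment_at I (n%:Z + (l + i%:Z)) x
    = boundary_term r a D K n x + c.
Proof.
move=> Ditv Kr ode Im Cl Clu.
(* [F] is the left side of the recurrence before grouping by diagonals, in a form that can be
   differentiated term by term. *)
pose F x := \sum_(j < r.+1) \sum_(s < size (a j))
  weight n j s * moment_at I (n%:Z + (s%:Z - j%:Z)) x.
have [|c Fc] := @has_deriv_on_eq0_cst _ D
    (fun x => F x - boundary_term r a D K n x) Ditv.1.
  move=> x Dx.
  have bx := has_deriv_on_boundary_term (n := n) Ditv Dx Kr (ode x Dx).
  rewrite -(subrr (\sum_(j < r.+1) \sum_(s < size (a j))
    weight n j s * x ^+ (n + s - j) * K x)).
  apply: has_deriv_onD; last exact: has_deriv_onN.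
  apply: has_deriv_on_sum => j _ _; apply: has_deriv_on_sum => s _ _.
  (* When n + s < j, the falling factorial makes the weight zero, so neither the default value of
     [moment_at] nor the truncated exponent matters. *)
  have [jns|nsj] := leqP j (n + s); last first.
    rewrite /weight falling_nat_eq0// mulr0 !mul0r.
    under eq_fun do rewrite mul0r.
    exact: has_deriv_on_cst.
  have -> : n%:Z + (s%:Z - j%:Z) = (n + s - j)%N%:Z by lia.
  by rewrite -mulrA; apply: has_deriv_onZ; exact: Im.
exists c => x Dx.
have := @sum_moment_coef l u n (fun k => moment_at I (n%:Z + k) x) Cl Clu.
by move=> ->; rewrite -(Fc x Dx) -/(F x); ring.
Qed.

End MomentRecurrence.

(** * Functions reducible to finitely many moments and boundary terms *)

Section MomentReduction.
Context {R : realType}.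
Context (r : nat) (D : set R) (K : R -> R) (I : nat -> R -> R).
Context (S : {fset nat}).
Implicit Types F G : R -> R.

(** This isolates the last conclusion of the theorem for a fixed [S] and an arbitrary function, so
    that closure under linear combinations can drive the induction. *)
Definition moment_reducible F : Prop :=
  exists (c : R) (alpha : nat -> R) (M : nat) (beta : nat -> nat -> R),
    forall x, D x ->
      F x = \sum_(s <- S) alpha s * I s x
            + \sum_(m < M) \sum_(i < r)
                beta m i * (x ^+ m * derivn_on D i K x)
            + c.

Lemma eq_moment_reducible F G : (forall x, D x -> F x = G x) ->
  moment_reducible G -> moment_reducible F.
Proof.
move=> FG [c [al [M [be GE]]]]; exists c, al, M, be => x Dx.
by rewrite FG// GE.
Qed.

Lemma moment_reducible_cst c : moment_reducible (fun=> c).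
Proof.
exists c, (fun=> 0), 0, (fun _ _ => 0) => x _.
by rewrite big_ord0 big1 ?add0r// => s _; rewrite mul0r.
Qed.

Lemma moment_reducible_moment n : n \in S -> moment_reducible (I n).
Proof.
move=> nS; exists 0, (fun s => (s == n)%:R), 0, (fun _ _ => 0) => x _.
rewrite big_ord0 !addr0 (bigD1_seq n)//= eqxx mul1r big1 ?addr0// => s.
by move=> /negPf ->; rewrite mul0r.
Qed.

Lemma moment_reducible_boundary m i : (i < r)%N ->
  moment_reducible (fun x => x ^+ m * derivn_on D i K x).
Proof.
move=> ir.
(* The coefficients are Kronecker deltas; the bound [m.+1] makes [m] the index [ord_max]. *)
exists 0, (fun=> 0), m.+1, (fun m' i' => ((m' == m) && (i' == i))%:R) => x _.
rewrite big1 ?add0r ?addr0 => [|s _]; last by rewrite mul0r.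
rewrite (bigD1 ord_max)//= (bigD1 (Ordinal ir))//= !eqxx mul1r.
rewrite big1 ?addr0 => [|i' ii]; last first.
  by rewrite -[X in X == i]/(val i') (negPf (_ : val i' != i)) ?mul0r.
rewrite big1 ?addr0// => m' mm; rewrite big1// => i' _.
by rewrite (negPf (_ : val m' != m)) ?mul0r.
Qed.

Lemma moment_reducibleD F G : moment_reducible F -> moment_reducible G ->
  moment_reducible (fun x => F x + G x).
Proof.
move=> [c [al [M [be FE]]]] [c' [al' [M' [be' GE]]]].
(* The two exponent bounds may differ, so both families of coefficients are padded with zeros up to
   the larger one. *)
have widen N (b : nat -> nat -> R) x : (N <= maxn M M')%N ->
    \sum_(m < N) \sum_(i < r) b m i * (x ^+ m * derivn_on D i K x) =
    \sum_(m < maxn M M') \sum_(i < r)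
      (if (m < N)%N then b m i else 0) * (x ^+ m * derivn_on D i K x).
  move=> NM; rewrite (big_ord_widen _ (fun m : nat =>
    \sum_(i < r) b m i * (x ^+ m * derivn_on D i K x)) NM) big_mkcond/=.
  apply: eq_bigr => m _; case: ifP => // _.
  by rewrite big1// => i _; rewrite mul0r.
exists (c + c'), (fun s => al s + al' s), (maxn M M'),
  (fun m i => (if (m < M)%N then be m i else 0) +
              (if (m < M')%N then be' m i else 0)) => x Dx.
rewrite FE// GE// (widen M) ?leq_maxl// (widen M') ?leq_maxr//.
under [in RHS]eq_bigr do rewrite mulrDl.
rewrite big_split/=.
under [X in _ = _ + X + _]eq_bigr do
  (under eq_bigr do rewrite mulrDl; rewrite big_split/=).
rewrite big_split/=; ring.
Qed.

Lemma moment_reducibleZ k F :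
  moment_reducible F -> moment_reducible (fun x => k * F x).
Proof.
move=> [c [al [M [be FE]]]].
exists (k * c), (fun s => k * al s), M, (fun m i => k * be m i) => x Dx.
rewrite FE// !mulrDr !mulr_sumr; congr (_ + _ + _).
  by apply: eq_bigr => s _; rewrite mulrA.
by apply: eq_bigr => m _; rewrite mulr_sumr; apply: eq_bigr => i _; rewrite mulrA.
Qed.

Lemma moment_reducible_sum (J : eqType) (s : seq J) (F : J -> R -> R) :
  (forall i, i \in s -> moment_reducible (F i)) ->
  moment_reducible (fun x => \sum_(i <- s) F i x).
Proof.
elim: s => [|i s IHs] FJ.
  apply: eq_moment_reducible (moment_reducible_cst 0) => x _.
  by rewrite big_nil.
apply: (@eq_moment_reducible _ (fun x => F i x + \sum_(k <- s) F k x)).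
  by move=> x _; rewrite big_cons.
apply: moment_reducibleD; first exact: FJ (mem_head _ _).
by apply: IHs => k ks; apply: FJ; rewrite inE ks orbT.
Qed.

Lemma moment_reducible_boundary_term (a : nat -> {poly R}) n :
  moment_reducible (boundary_term r a D K n).
Proof.
apply: (@eq_moment_reducible _ (fun x => -1 * \sum_(1 <= j < r.+1)
  \sum_(s < size (a j)) (a j)`_s * \sum_(t < j) (-1) ^+ t *
    falling ((n + s)%:R : R) t * (x ^+ (n + s - t) * derivn_on D (j - 1 - t) K x))).
  move=> x _; rewrite /boundary_term mulN1r; congr (- _).
  apply: eq_bigr => j _; apply: eq_bigr => s _; congr (_ * _).
  by apply: eq_bigr => t _; rewrite !mulrA.
apply: moment_reducibleZ; apply: moment_reducible_sum => j.
rewrite mem_index_iota => /andP[_ jr].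
apply: moment_reducible_sum => s _; apply: moment_reducibleZ.
apply: moment_reducible_sum => t _; apply: moment_reducibleZ.
(* The order j - 1 - t is at most r - 1 because j is at most r. *)
by apply: moment_reducible_boundary; have := ltn_ord t; lia.
Qed.

End MomentReduction.

(** * Solving for the top moment and reducing by induction *)

Theorem theorem5p3 (R : realType) (r : nat) (a : nat -> {poly R})
    (D : set R) (K : R -> R) (I : nat -> R -> R) (l u : int)
    (r_ge1 : (1 <= r)%N)
    (ar_neq0 : a r != 0)
    (D_itv : proper_interval D)
    (K_derivable : n_times_derivable_on D r K)
    (K_ode : forall x, D x ->
       \sum_(j < r.+1) (a j).[x] * derivn_on D j K x = 0)
    (I_moment : forall n,
       antiderivative_on D (fun x => x ^+ n * K x) (I n))
    (Cl_neq0 : moment_coef r a l != 0)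
    (l_min : forall k, moment_coef r a k != 0 -> l <= k)
    (Cu_neq0 : moment_coef r a u != 0)
    (u_max : forall k, moment_coef r a k != 0 -> k <= u) :
  [/\ finite_set (resonant r a u),
      (forall n : nat, ~ resonant r a u n ->
         exists c : R, forall x, D x ->
           moment_at I (n%:Z + u) x =
             - (1 / (moment_coef r a u).[n%:R]) *
                 (\sum_(0 <= i < `|u - l|)
                    (moment_coef r a (l + i%:Z)).[n%:R] *
                      moment_at I (n%:Z + (l + i%:Z)) x)
             + boundary_term r a D K n x / (moment_coef r a u).[n%:R]
             + c) &
      exists S : {fset nat}, \forall N \near \oo,
        exists (c : R) (alpha : nat -> R) (M : nat) (beta : nat -> nat -> R),
          forall x, D x ->
            I N x = \sum_(s <- S) alpha s * I s x
                    + \sum_(m < M) \sum_(i < r)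
                        beta m i * (x ^+ m * derivn_on D i K x)
                    + c].
Proof.
have Clu k : moment_coef r a k != 0 -> l <= k <= u.
  by move=> Ck; rewrite l_min// u_max.
have lu : l <= u by exact: l_min.
have recurrence n : ~ resonant r a u n -> exists c : R, forall x, D x ->
    moment_at I (n%:Z + u) x =
      - (1 / (moment_coef r a u).[n%:R]) *
          (\sum_(0 <= i < `|u - l|)
             (moment_coef r a (l + i%:Z)).[n%:R] *
               moment_at I (n%:Z + (l + i%:Z)) x)
      + boundary_term r a D K n x / (moment_coef r a u).[n%:R]
      + c.
  move=> /eqP Cun.
  have [c cE] := moment_recurrence n D_itv K_derivable K_ode I_moment
    Cl_neq0 Clu.
  exists (c / (moment_coef r a u).[n%:R]) => x Dx.
  (* The last summand is the one with k = u; its coefficient is invertible at a nonresonant [n]. *)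
  have := cE x Dx; rewrite big_nat_recr//= (_ : l + `|u - l|%N = u); last lia.
  set A := \sum_(0 <= i < _) _.
  by move=> /(canRL (addKr _)) /(canRL (mulKf Cun)) ->; field.
have res_fin : finite_set (resonant r a u).
  exact: polynomial_finite_nat_roots Cu_neq0.
split=> //.
have [n0 n0P] : exists n0, forall n, (n0 <= n)%N -> ~ resonant r a u n.
  have /finite_fsetP[X resX] := res_fin.
  exists (\max_(k <- X) k).+1 => n Xn; rewrite resX /= => nX.
  by move: Xn; rewrite ltnNge (leq_bigmax_seq _ nX).
(* For [N >= N0], the index N - u is nonnegative and at least [n0], hence not resonant. *)
pose N0 := (n0 + `|u|)%N.
pose S : {fset nat} := [fset s | s in iota 0 N0]%fset.
(* The reduction holds for every [N]: indices below [N0] belong to [S] themselves. *)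
exists S; apply: nearW => N; change (moment_reducible r D K I S (I N)).
have [m] := ubnP N; elim: m N => // m IHm N Nm.
have [NN0|N0N] := ltnP N N0.
  by apply: moment_reducible_moment; rewrite !inE/= mem_iota add0n.
pose n := absz (N%:Z - u)%R.
have nE : n%:Z + u = N by rewrite /n; lia.
have [|c cE] := recurrence n; first by apply: n0P; rewrite /n; lia.
rewrite nE in cE.
apply: eq_moment_reducible cE _.
apply: moment_reducibleD; last exact: moment_reducible_cst.
apply: moment_reducibleD.
  apply: moment_reducibleZ; apply: moment_reducible_sum => i.
  rewrite mem_index_iota => /andP[_ iul]; apply: moment_reducibleZ.
  (* A nonnegative index n + l + i is less than n + u = N, so induction applies; at a negative one
     [moment_at] is the zero function. *)
  case nk : (n%:Z + (l + i%:Z)) => [k|k]; last exact: moment_reducible_cst.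
  by apply: IHm; lia.
apply: (@eq_moment_reducible _ _ _ _ _ _ _ (fun x =>
  (moment_coef r a u).[n%:R]^-1 * boundary_term r a D K n x)).
  by move=> x _; rewrite mulrC.
by apply: moment_reducibleZ; exact: moment_reducible_boundary_term.
Qed.
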